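(* Let $n\ge1$, let $\vec a=(a_0,\dots,a_n)$ be a tropical boolean vector (i.e. $a_0=a_n=0$ and $a_i\in\{0,\infty\}$ for all $i$), let $G=G_{\vec a}$ be the finite directed graph defined in the context, $d=d_{\vec a}$ the tropical Hilbert function and $H=H_{\vec a}$ the tropical entropy. Let $\mathcal{H}$ be the maximum over simple cycles of $G$ of the quotient of the number of augmenting edges to the length of the cycle; a simple cycle attaining this maximum is called optimal. Let $V$ be the number of vertices of $G$ and $R$ the least common multiple of the lengths of all optimal simple cycles. Then: (a) $d(k)\ge\mathcal{H}(k-n)$; (b) $d(k)\le\mathcal{H}k+(1-\mathcal{H})(V+n)$; (c) $\mathcal{H}=H$; (d) any path $T$ in $G$ of length $k-n$ greater than $V^2(V+n)+V$ such that $n(T)+d(T)=d(k)$ contains a vertex from an optimal simple cycle; (e) for any $k>(V^2+1)(V+n)$, $d(k+R)\ge d(k)+HR$; (f) if for some $k>(V^2+1)(V+n)$ we have $d(k+iR)=d(k)+HiR$ for all integers $0\le i\le V((1-H)V+n+1)$, then $d(k+jR)=d(k)+HjR$ for every integer $j\ge0$.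
   Context: A real sequence $(z_1,\dots,z_k)$ satisfies $\vec a$ if for every $1\le j\le k-n$ the (finite) minimum $\min_{0\le i\le n}\{z_{j+i}+a_i\}$ is attained for at least two different values of $i$; terms with $a_i=\infty$ equal $\infty$. $d_{\vec a}(k)$ is the dimension of the set (a finite union of polyhedra) of all such sequences in $\mathbb{R}^k$, and $H_{\vec a}:=\lim_{k\to\infty}d_{\vec a}(k)/k$ (the limit exists by subadditivity of $d_{\vec a}$). Vertices of $G$: they correspond to the nonempty polyhedra $P_v\subset\mathbb{R}^n$ obtained by imposing, for each pair of coordinates $y_r,y_t$, exactly one of $y_r=y_t$, $y_r<y_t$, $y_t<y_r$ (i.e. to the weak orderings of the $n$ coordinates). Edges of $G$: there is an edge $(v,w)$ iff there exist $(y_0,\dots,y_{n-1})\in P_v$ and $(y_1,\dots,y_n)\in P_w$ such that $(y_0,\dots,y_n)$ satisfies $\vec a$. For a vertex $v$ and $(y_0,\dots,y_{n-1})\in P_v$ let $S_v$ be the set of $t\in\{0,\dots,n-1\}$ with $a_t+y_t=\min_{0\le j\le n-1}\{a_j+y_j\}$ (independent of the point). An edge $(v,w)$ is augmenting if $S_v\ne\{0\}$ and on $P_w$ the last coordinate is different from each of the first $n-1$ coordinates; otherwise it is rigid. For a path $T$ in $G$ (its length is the number of its edges), $d(T)$ is the number of augmenting edges in $T$ (counted along the path), and $n(T)\le n$ is the number of pairwise distinct coordinates of a point of $P_{v_0}$, $v_0$ being the first vertex of $T$. Loops count as simple cycles of length 1. *)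

(* Defs.v *)
From HB Require Import structures.
From mathcomp Require Import all_boot all_order all_algebra.
From mathcomp Require Import all_classical all_reals all_analysis.
Import Order.TTheory GRing.Theory Num.Theory.
Import numFieldNormedType.Exports.

Set Implicit Arguments.
Unset Strict Implicit.
Unset Printing Implicit Defensive.

Local Open Scope classical_set_scope.
Local Open Scope ring_scope.

Section Dimension.
Variables (R : realType) (k : nat).
Implicit Types (A P X : set 'rV[R]_k).

Definition polyhedron P : Prop :=
  exists (p : nat) (M : 'M[R]_(k, p)) (b : 'rV[R]_p),
    P = [set x | forall i, (x *m M) 0 i <= b 0 i].

Definition affinely_independent m (x : 'I_m -> 'rV[R]_k) : Prop :=
  forall c : 'I_m -> R,
    \sum_i c i = 0 -> \sum_i c i *: x i = 0 -> forall i, c i = 0.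

(* The dimension of the affine hull of A, for nonempty A. *)
Definition affine_dim A : nat :=
  \max_(m < k.+1 | `[< exists x : 'I_m.+1 -> 'rV[R]_k,
      affinely_independent x /\ forall i, A (x i) >]) m.

(* Meant for finite unions of polyhedra, whose dimension is the largest
   dimension of a member of the union: see polyhedral_dim_bigcup. *)
Definition polyhedral_dim X : nat :=
  \max_(m < k.+1 | `[< exists P,
      [/\ polyhedron P, P `<=` X & affine_dim P = m] >]) m.

Lemma affine_dim_le A : (affine_dim A <= k)%N.
Proof. by apply/bigmax_leqP => m _; rewrite -ltnS. Qed.

Lemma affine_dim_geq A m (x : 'I_m.+1 -> 'rV[R]_k) : (m <= k)%N ->
  affinely_independent x -> (forall i, A (x i)) -> (m <= affine_dim A)%N.
Proof.
move=> mk xind xA; rewrite -[m]/(nat_of_ord (Ordinal (mk : m < k.+1)%N)).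
by apply: (@leq_bigmax_cond _ _ (fun i : 'I_k.+1 => nat_of_ord i));
  apply/asboolP; exists x.
Qed.

Lemma affine_dim_witness A : (0 < affine_dim A)%N ->
  exists x : 'I_(affine_dim A).+1 -> 'rV[R]_k,
    affinely_independent x /\ forall i, A (x i).
Proof.
pose B := [pred m : 'I_k.+1 | `[< exists x : 'I_m.+1 -> 'rV[R]_k,
  affinely_independent x /\ forall i, A (x i) >]].
have [B0|] := posnP #|B|.
  by rewrite /affine_dim big_pred0// => m; move/card0_eq: B0 => /(_ m).
move=> /(eq_bigmax_cond (fun m : 'I_k.+1 => nat_of_ord m))[m mB Am] _.
have -> : affine_dim A = m by rewrite -Am.
by move: mB => /asboolP.
Qed.

Lemma polyhedron_convex P m (x : 'I_m -> 'rV[R]_k) (c : 'I_m -> R) :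
  polyhedron P -> (forall i, P (x i)) -> (forall i, 0 <= c i) ->
  \sum_i c i = 1 -> P (\sum_i c i *: x i).
Proof.
move=> [p [M [b ->]]] xP c0 c1 j /=.
rewrite mulmx_suml summxE -[leRHS]mul1r -c1 mulr_suml.
by apply: ler_sum => i _; rewrite -scalemxAl mxE ler_wpM2l// xP.
Qed.

Lemma pigeonhole (I : finType) m (f : nat -> I) :
  exists i (t : 'I_m.+1 -> nat), injective t /\ forall j, f (t j) = i.
Proof.
pose N := (#|I| * m).+1.
have [/existsP[i im]|/existsPn small] :=
    boolP [exists i, (m < #|[set t : 'I_N | f t == i]%SET|)%N].
  exists i, (fun j => enum_val (widen_ord im j) : nat); split.
    by move=> j1 j2 /val_inj/enum_val_inj/(congr1 val)/= /val_inj.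
  by move=> j; have := enum_valP (widen_ord im j); rewrite inE => /eqP.
have : (#|'I_N| <= #|I| * m)%N.
  rewrite -sum1_card (partition_big (fun t : 'I_N => f t) predT)//=.
  rewrite -sum_nat_const; apply: leq_sum => i _.
  by rewrite sum1dep_card leqNgt; exact: small.
by rewrite card_ord ltnn.
Qed.

Lemma affinely_independent_curve m (x : 'I_m.+1 -> 'rV[R]_k)
    (t : 'I_m.+1 -> R) (s : 'I_m.+1 -> R) :
  affinely_independent x -> injective t ->
  (forall i, s i != 0) -> (forall i, \sum_(j < m.+1) t i ^+ j = s i) ->
  affinely_independent (fun i => \sum_(j < m.+1) (t i ^+ j / s i) *: x j).
Proof.
move=> xind tinj s0 sE c c0 cx i.
pose e : 'rV[R]_m.+1 := \row_i (c i / s i).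
have e0 : forall j : 'I_m.+1, \sum_i c i * (t i ^+ j / s i) = 0.
  apply: xind.
    rewrite exchange_big/= -[RHS]c0; apply: eq_bigr => l _.
    by rewrite -mulr_sumr -mulr_suml sE divff// mulr1.
  rewrite -[RHS]cx.
  under eq_bigr do rewrite scaler_suml.
  rewrite exchange_big/=; apply: eq_bigr => l _.
  by rewrite scaler_sumr; apply: eq_bigr => j _; rewrite scalerA.
pose Vm := Vandermonde m.+1 (\row_i t i).
have Vunit : Vm^T \in unitmx.
  rewrite unitmx_tr unitmxE det_Vandermonde unitfE.
  apply/prodf_neq0 => a _; apply/prodf_neq0 => b ab.
  rewrite !mxE subr_eq0; apply: contraTneq ab => /tinj ->.
  by rewrite ltnn.
have : e *m Vm^T = 0.
  apply/rowP => j; rewrite !mxE -[RHS](e0 j); apply: eq_bigr => l _.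
  by rewrite !mxE mulrAC mulrA.
move/(congr1 (mulmx^~ (invmx Vm^T))); rewrite mulmxK// mul0mx.
move/rowP/(_ i); rewrite !mxE => /eqP.
by rewrite mulf_eq0 invr_eq0 (negbTE (s0 i)) orbF => /eqP.
Qed.

Lemma polyhedral_dim_bigcup (I : finType) (P : I -> set 'rV[R]_k) :
  (forall i, polyhedron (P i)) ->
  polyhedral_dim (\bigcup_i P i) = \max_i affine_dim (P i).
Proof.
move=> Ppoly; apply/eqP; rewrite eqn_leq; apply/andP; split; last first.
  apply/bigmax_leqP => i _.
  rewrite -[affine_dim _]
    /(nat_of_ord (Ordinal (affine_dim_le (P i) : _ < k.+1)%N)).
  apply: (@leq_bigmax_cond _ _ (fun i : 'I_k.+1 => nat_of_ord i)).
  by apply/asboolP; exists (P i); split=> // y Piy; exists i.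
apply/bigmax_leqP => m /asboolP[Q [Qpoly QP Qm]].
have [->//|m0] := posnP m.
move: (affine_dim_witness (A := Q)); rewrite Qm => /(_ m0)[x [xind xQ]].
pose t l : R := l.+1%:R.
pose s l : R := \sum_(j < m.+1) t l ^+ j.
have s0 l : 0 < s l.
  rewrite /s big_ord_recl expr0 ltr_pwDl// sumr_ge0// => j _.
  by rewrite exprn_ge0// ler0n.
pose p l := \sum_(j < m.+1) (t l ^+ j / s l) *: x j.
have pP l : exists i, P i (p l).
  have [i _ ?] : (\bigcup_i P i) (p l); last by exists i.
  pose c (j : 'I_m.+1) := t l ^+ j / s l.
  apply/QP/(polyhedron_convex (c := c)) => // [j|].
    by rewrite divr_ge0// ?(ltW (s0 l))// exprn_ge0// ler0n.
  by rewrite -mulr_suml -/(s l) divff// gt_eqF// s0.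
have [f fP] := choice pP.
have [i [u [uinj fu]]] := pigeonhole m f.
apply: leq_trans (leq_bigmax i).
apply: (affine_dim_geq (x := p \o u)); first by rewrite -ltnS.
  apply: (@affinely_independent_curve _ _ (t \o u) (s \o u)) => //.
    by move=> a b /= /eqP; rewrite eqr_nat eqSS => /eqP/uinj.
  by move=> a /=; rewrite gt_eqF// s0.
by move=> j; rewrite -(fu j); exact: fP.
Qed.

End Dimension.

Section TropicalRecurrence.
Variables (R : realType) (n : nat) (a : 'I_n.+1 -> \bar R).

Definition tropical_boolean : Prop :=
  [/\ a ord0 = 0%E, a ord_max = 0%E & forall i, a i = 0%E \/ a i = +oo%E].

Lemma window_subproof k (j : 'I_(k - n)) (i : 'I_n.+1) : (j + i < k)%N.
Proof.
have jn : (j + n < k)%N by rewrite addnC -ltn_subRL.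
by rewrite (leq_ltn_trans _ jn)// leq_add2l -ltnS.
Qed.

Definition window k (j : 'I_(k - n)) (i : 'I_n.+1) : 'I_k :=
  Ordinal (window_subproof j i).

Definition min_attained_twice m (f : 'I_m -> \bar R) : Prop :=
  exists i1 i2, [/\ i1 != i2, f i1 = \big[mine/+oo%E]_i f i
                            & f i2 = \big[mine/+oo%E]_i f i].

(* The index type 'I_(k - n) is empty when k <= n. *)
Definition satisfies k (z : 'rV[R]_k) : Prop :=
  forall j : 'I_(k - n),
    min_attained_twice (fun i => (z 0 (window j i))%:E + a i)%E.

Definition tropical_hilbert k : nat :=
  polyhedral_dim [set z : 'rV[R]_k | satisfies z].

Definition hilbert_quotient k : R := (tropical_hilbert k)%:R / k%:R.

Definition tropical_entropy : R := lim (hilbert_quotient @ \oo).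

End TropicalRecurrence.

Section Graph.
Variables (R : realType) (n : nat).

(* v(r, t) prescribes the truth value of y_r <= y_t; the values at (r, t) and
   (t, r) together impose one of y_r = y_t, y_r < y_t, y_t < y_r (two false
   values are contradictory). *)
Definition order_cell (v : {ffun 'I_n * 'I_n -> bool}) : set 'rV[R]_n :=
  [set y | forall r t, (y 0 r <= y 0 t) = v (r, t)].

Definition vertex :=
  {v : {ffun 'I_n * 'I_n -> bool} | `[< order_cell v !=set0 >]}.

HB.instance Definition _ := Finite.on vertex.

Definition cell (v : vertex) : set 'rV[R]_n := order_cell (val v).

Definition cell_point (v : vertex) : 'rV[R]_n := xget 0 (cell v).

Definition nb_distinct (v : vertex) : nat :=
  size (undup [seq cell_point v 0 i | i : 'I_n]).

Variable a : 'I_n.+1 -> \bar R.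

Definition init_row (y : 'rV[R]_n.+1) : 'rV[R]_n :=
  \row_i y 0 (widen_ord (leqnSn n) i).

Definition tail_row (y : 'rV[R]_n.+1) : 'rV[R]_n := \row_i y 0 (lift ord0 i).

Definition edge : rel vertex := fun v w =>
  `[< exists y : 'rV[R]_n.+1,
        [/\ cell v (init_row y), cell w (tail_row y) & satisfies a y] >].

Definition shifted (y : 'rV[R]_n) (t : 'I_n) : \bar R :=
  (a (widen_ord (leqnSn n) t) + (y 0 t)%:E)%E.

Definition min_set (v : vertex) : {set 'I_n} :=
  [set t | shifted (cell_point v) t
             == \big[mine/+oo%E]_j shifted (cell_point v) j]%SET.

Definition last_is_new (w : vertex) : Prop :=
  forall y, cell w y ->
    forall t l : 'I_n, (t < l)%N -> l.+1 = n -> y 0 l <> y 0 t.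

Definition augmenting : rel vertex := fun v w =>
  [&& edge v w, min_set v != [set t : 'I_n | t == 0%N :> nat]%SET
    & `[< last_is_new w >]].

Definition path_augmenting (v : vertex) (p : seq vertex) : nat :=
  count (fun e => augmenting e.1 e.2) (zip (v :: p) p).

Definition simple_cycle (c : seq vertex) : bool :=
  [&& c != [::], cycle edge c & uniq c].

Definition cycle_augmenting (c : seq vertex) : nat :=
  count (fun e => augmenting e.1 e.2) (zip c (rot 1 c)).

Definition cycle_ratio (c : seq vertex) : R :=
  (cycle_augmenting c)%:R / (size c)%:R.

(* A simple cycle has at most #|vertex| vertices, so the sequences of bounded
   size range over all of them. The initial value 0 is harmless: ratios are
   nonnegative, and every vertex has an outgoing edge when a is boolean and
   n > 0, so that there is a cycle. *)
Definition max_ratio : R :=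
  \big[Num.max/0]_(c : {bseq #|{: vertex}| of vertex} | simple_cycle c)
    cycle_ratio c.

Definition optimal_cycle (c : seq vertex) : bool :=
  simple_cycle c && (cycle_ratio c == max_ratio).

Definition optimal_period : nat :=
  \big[lcmn/1%N]_(c : {bseq #|{: vertex}| of vertex} | optimal_cycle c) size c.

End Graph.

(* Main.v *)
(* As a is boolean, whether z satisfies a depends only on the weak order of the
   coordinates of z. The solution set is thus a finite union of closed cones of
   weak orders, and the cone of z has as many dimensions as z has distinct
   values: d(k) is the largest number of distinct values of a solution of
   length k. The windows of a solution form a path T of length k - n, in which
   every value distinct from all the previous ones sits on an augmenting edge;
   conversely, along any path one builds a solution that takes a fresh value on
   each augmenting edge. Hence d(k) is the maximum of n(T) + d(T) over paths T
   of length k - n.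

   The rest is a study of walks in a finite graph. Give an edge the weight 1 or
   0, according to whether it is augmenting, minus calH. Closed walks then have
   nonpositive weight, optimal cycles have weight 0 and the other simple cycles
   of length m have weight at most - m / V^2; removing simple cycles from a walk
   yields (b) and (d), winding around an optimal cycle yields (a) and (e). For
   (f), a walk of length at least V L visits the same vertex at two times
   congruent modulo L; the closed walk in between has length i L with i <= V and
   can be removed. *)
Require Import Defs.
From mathcomp Require Import all_boot all_order all_algebra.
From mathcomp Require Import all_classical all_reals all_analysis.
From mathcomp Require Import zify lra.
Import Order.TTheory GRing.Theory Num.Theory.
Import numFieldNormedType.Exports.

Set Implicit Arguments.
Unset Strict Implicit.
Unset Printing Implicit Defensive.

(** * Walks in a finite graph *)

Section Walks.
Variables (T : finType) (e g : rel T).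
Implicit Types (u v w : T) (p q c : seq T).

(** Convertible to [path_augmenting] when [g] is [augmenting a], but over any finite graph; likewise
    [cycle_count] and [cycle_augmenting]. *)
Definition walk_count v p : nat := count (fun x => g x.1 x.2) (zip (v :: p) p).

Lemma walk_count_cons v w p : walk_count v (w :: p) = g v w + walk_count w p.
Proof. by []. Qed.

Lemma walk_count_cat v p q :
  walk_count v (p ++ q) = walk_count v p + walk_count (last v p) q.
Proof.
elim: p v => [//|w p IH] v.
by rewrite cat_cons !walk_count_cons IH addnA.
Qed.

Lemma walk_count_rcons v p w :
  walk_count v (rcons p w) = walk_count v p + g (last v p) w.
Proof. by rewrite -cats1 walk_count_cat walk_count_cons addn0. Qed.

Lemma walk_count_le_size v p : walk_count v p <= size p.
Proof.
by rewrite (leq_trans (count_size _ _))// size_zip geq_minr.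
Qed.

Definition cycle_count c : nat :=
  count (fun x => g x.1 x.2) (zip c (rot 1 c)).

Lemma cycle_count_cons u q : cycle_count (u :: q) = walk_count u (rcons q u).
Proof.
rewrite /cycle_count rot1_cons /walk_count; congr count.
elim: q {1 3}u => [//|x q IH] y /=; congr cons; exact: IH.
Qed.

(** Rotating [c] to start at [u] keeps its edges and yields a closed walk that can be spliced into
    other walks. *)
Lemma cycle_unroll u c : u \in c -> cycle e c ->
  exists q, [/\ path e u (rcons q u), walk_count u (rcons q u) = cycle_count c
              & (size q).+1 = size c].
Proof.
case/splitPr=> -[|x c1] c2; first by rewrite cycle_count_cons; exists c2.
move=> ec; exists (c2 ++ x :: c1); rewrite cat_cons cycle_count_cons.
split.
- move: ec; rewrite /= !rcons_cat !rcons_cons -!cat_rcons !cat_path !last_rcons.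
  by move=> /andP[-> ->].
- rewrite !rcons_cat !rcons_cons -!cat_rcons !walk_count_cat !last_rcons.
  by rewrite addnC.
- by rewrite /= !size_cat /=; lia.
Qed.

(** The first return to a vertex already visited closes up a simple cycle; induction from the right
    finds it. *)
Lemma nonuniq_walk_split v p : ~~ uniq (v :: p) ->
  exists p1 u q p2, [/\ p = p1 ++ rcons q u ++ p2, last v p1 = u & uniq (u :: q)].
Proof.
elim/last_ind: p => [//|p x IH].
have [vp_uniq|/IH[p1 [u [q [p2 [-> lu uq]]]]]] := boolP (uniq (v :: p)); last first.
  by exists p1, u, q, (rcons p2 x); rewrite -!rcons_cat.
rewrite -rcons_cons rcons_uniq vp_uniq andbT negbK inE => /predU1P[->|].
  by exists [::], v, p, [::]; rewrite cats0.
move=> xp; case/splitPr: xp vp_uniq {IH} => p1 p2 vp_uniq.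
exists (rcons p1 x), x, p2, [::]; rewrite cats0 last_rcons.
rewrite cat_rcons rcons_cat; split => //.
by move: vp_uniq; rewrite -cat_cons cat_uniq => /and3P[].
Qed.

(** * Removing simple cycles from a walk *)

Section Excise.
Variables (R : realFieldType) (h : R) (A : {pred T}).
Hypothesis simple_le : forall u q, {subset u :: q <= A} ->
  cycle e (u :: q) -> uniq (u :: q) ->
  ((walk_count u (rcons q u))%:R <= h * (size q).+1%:R)%R.

(** Excising a simple cycle never lowers the count minus [h] times the length. Confinement to [A]
    permits a smaller [h] for walks that avoid optimal cycles. *)
Lemma walk_reduce v p : path e v p -> {subset v :: p <= A} ->
  exists p', [/\ path e v p', last v p' = last v p, uniq (v :: p') &
    ((walk_count v p)%:R - h * (size p)%:R
      <= (walk_count v p')%:R - h * (size p')%:R)%R].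
Proof.
have [m] := ubnP (size p); elim: m p => // m IH p pm ep pA.
have [vp_uniq|] := boolP (uniq (v :: p)); first by exists p.
move=> /nonuniq_walk_split[p1 [u [q [p2 [pE lu uq]]]]].
move: (ep); rewrite {1}pE !cat_path lu last_rcons => /and3P[ep1 eq ep2].
have sz : size p = size (p1 ++ p2) + (size q).+1.
  by rewrite pE !size_cat size_rcons addnCA addnC.
case: (IH (p1 ++ p2)).
- by rewrite sz addnS ltnS in pm; apply: leq_ltn_trans pm; rewrite leq_addr.
- by rewrite cat_path ep1 lu.
- move=> x xp; apply: pA; move: xp; rewrite pE !inE !mem_cat.
  by case/or3P => ->; rewrite ?orbT.
move=> p' [ep' lp' up' cp']; exists p'; split => //.
  by rewrite lp' pE !last_cat last_rcons lu.
apply: le_trans cp'.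
have := @simple_le u q _ eq uq.
have qA : {subset u :: q <= A}.
  move=> x xq; apply: pA; rewrite pE inE !mem_cat mem_rcons xq.
  by rewrite orbT orbT.
move=> /(_ qA).
rewrite sz {1}pE !walk_count_cat lu last_rcons !natrD; lra.
Qed.

(** The reduced walk has at most [#|T|.-1] edges, each of weight at most [1 - h]. *)
Lemma walk_count_le v p : (h <= 1)%R -> path e v p -> {subset v :: p <= A} ->
  ((walk_count v p)%:R <= h * (size p)%:R + (1 - h) * #|T|.-1%:R)%R.
Proof.
move=> h1 ep /(walk_reduce ep)[p' [_ _ up' le']].
have sp' : ((size p')%:R <= #|T|.-1%:R :> R)%R.
  rewrite ler_nat -ltnS prednK; last by apply/card_gt0P; exists v.
  by rewrite -[(size p').+1]/(size (v :: p')) -(card_uniqP up') max_card.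
have cp' : ((walk_count v p')%:R <= (size p')%:R :> R)%R.
  by rewrite ler_nat walk_count_le_size.
have := ler_wpM2l (_ : 0 <= 1 - h)%R sp'; rewrite subr_ge0 => /(_ h1).
lra.
Qed.

(** The reduced walk is closed without repeated vertices, hence empty. *)
Lemma closed_walk_count_le v p : path e v p -> last v p = v ->
  {subset v :: p <= A} -> ((walk_count v p)%:R <= h * (size p)%:R)%R.
Proof.
move=> ep lv /(walk_reduce ep)[p' [_ lp' up' le']].
have p'0 : p' = [::].
  case/lastP: p' lp' up' {le'} => // s x.
  rewrite last_rcons lv => ->.
  by rewrite /= mem_rcons inE eqxx.
move: le'; rewrite p'0 /walk_count /=; lra.
Qed.

End Excise.

Lemma walk_count_le_mul m l B :
  (forall v p, path e v p -> size p = l -> walk_count v p <= B) ->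
  forall v p, path e v p -> size p = m * l -> walk_count v p <= m * B.
Proof.
move=> Bl; elim: m => [|m IH] v p; first by move=> _ /size0nil->.
rewrite -[p in path _ _ p](cat_take_drop l p) cat_path => /andP[ep1 ep2].
rewrite mulSn => sp.
have s1 : size (take l p) = l by rewrite size_takel// sp leq_addr.
rewrite -[p](cat_take_drop l p) walk_count_cat mulSn leq_add ?Bl//.
by rewrite IH// size_drop sp addKn.
Qed.

(** * Repeating and cutting out closed walks *)

Definition wind m c : seq T := flatten (nseq m c).

Lemma size_wind m c : size (wind m c) = m * size c.
Proof.
by rewrite size_flatten /shape map_nseq sumn_nseq mulnC.
Qed.

Lemma wind_closed m u c : path e u c -> last u c = u ->
  [/\ path e u (wind m c), last u (wind m c) = u &
      walk_count u (wind m c) = m * walk_count u c].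
Proof.
move=> ec lc; elim: m => [//|m [IH1 IH2 IH3]].
rewrite /wind /= -/(wind m c) cat_path last_cat walk_count_cat lc IH3.
by rewrite ec IH1 IH2.
Qed.

(** Pigeonhole on the pairs (vertex at time [t], residue of [t] modulo [L]) for [t] from [0] to
    [#|T| * L]: there is one more time than there are pairs. *)
Lemma long_walk_split v p L : 0 < L -> #|T| * L <= size p ->
  exists p1 c p2, [/\ p = p1 ++ c ++ p2, last (last v p1) c = last v p1 &
    exists2 i, 0 < i <= #|T| & size c = i * L].
Proof.
case: L => // L _ sp.
pose f (t : 'I_(#|T| * L.+1).+1) : T * 'I_L.+1 :=
  (last v (take t p), inord (t %% L.+1)).
have /injectivePn[i [j ij fij]] : ~~ injectiveb f.
  apply/negP => /injectiveP/leq_card.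
  by rewrite card_prod !card_ord ltnn.
wlog lij : i j ij fij / i < j.
  move=> W; case: (ltngtP i j) => [|/W|/val_inj/eqP]; first exact: W.
    by apply; rewrite 1?eq_sym.
  by rewrite (negbTE ij).
case: fij => lastE /(congr1 (fun k : 'I_L.+1 => k : nat)).
rewrite !inordK ?ltn_pmod// => modE.
have jp : j <= size p by apply: leq_trans sp; rewrite -ltnS.
have ip : i <= size p by apply: leq_trans jp; exact: ltnW.
have takeE : take j p = take i p ++ take (j - i) (drop i p).
  by rewrite -takeD subnKC// ltnW.
exists (take i p), (take (j - i) (drop i p)), (drop j p); split.
- by rewrite catA -takeE cat_take_drop.
- by rewrite -last_cat -takeE.
have /dvdnP[k kE] : L.+1 %| j - i by rewrite -eqn_mod_dvd ?modE// ltnW.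
exists k; last by rewrite size_takel// size_drop leq_sub2r.
have k0 : 0 < k by case: k kE => //; lia.
have := ltn_ord j; rewrite ltnS => jle.
by rewrite k0 /= -(leq_pmul2r (ltn0Sn L)) -kE (leq_trans _ jle)// leq_subr.
Qed.

End Walks.

Local Open Scope classical_set_scope.
Local Open Scope ring_scope.

(** * Cones of weak orders *)

Lemma exists_left_kernel (F : fieldType) p m (N : 'M[F]_(p, m)) : (m < p)%N ->
  exists2 u : 'rV_p, u != 0 & u *m N = 0.
Proof.
move=> mp; have : kermx N != 0.
  rewrite -mxrank_eq0 mxrank_ker subn_eq0 -ltnNge.
  exact: leq_ltn_trans (rank_leq_col _) mp.
by move=> /rowV0Pn[u /sub_kermxP uN u0]; exists u.
Qed.

Section Cone.
Variables (R : realType) (k : nat).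
Implicit Types z y : 'rV[R]_k.

(** The closure of the weak-order cell of [z]: equalities persist, strict inequalities may become
    equalities. *)
Definition order_cone z : set 'rV[R]_k :=
  [set y | forall r t, z 0 r <= z 0 t -> y 0 r <= y 0 t].

Definition values z : seq R := undup [seq z 0 i | i : 'I_k].

Lemma values_uniq z : uniq (values z). Proof. exact: undup_uniq. Qed.

Lemma mem_values z i : z 0 i \in values z.
Proof. by rewrite mem_undup map_f// mem_enum. Qed.

Lemma size_values z : (size (values z) <= k)%N.
Proof.
by rewrite (leq_trans (size_undup _))// size_map size_enum_ord.
Qed.

Lemma order_cone_polyhedron z : polyhedron (order_cone z).
Proof.
(* One column per pair [(r, t)]: it expresses [y_r - y_t <= 0] if [z_r <= z_t], and [0 <= 0]
   otherwise. *)
exists #|{: 'I_k * 'I_k}|, (\matrix_(l, i) let rt := enum_val i in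
  if z 0 rt.1 <= z 0 rt.2 then (l == rt.1)%:R - (l == rt.2)%:R else 0), 0.
have E y i : (y *m (\matrix_(l, i) let rt := enum_val i in
    if z 0 rt.1 <= z 0 rt.2 then (l == rt.1)%:R - (l == rt.2)%:R else 0)) 0 i
    = let rt := enum_val i in
      if z 0 rt.1 <= z 0 rt.2 then y 0 rt.1 - y 0 rt.2 else 0.
  rewrite mxE /=; case: ifPn => zrt; last first.
    by rewrite big1// => l _; rewrite !mxE (negbTE zrt) mulr0.
  under eq_bigr do rewrite !mxE zrt mulrBr.
  have D t : \sum_l y 0 l * (l == t)%:R = y 0 t.
    rewrite (bigD1 t)//= eqxx mulr1 big1 ?addr0// => l /negbTE->.
    by rewrite mulr0.
  by rewrite sumrB !D.
apply/seteqP; split => y.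
  move=> yz i; rewrite E mxE /=; case: ifPn => // zrt.
  by rewrite subr_le0 yz.
move=> yM r t zrt; have := yM (enum_rank (r, t)).
by rewrite E mxE /= enum_rankK /= zrt subr_le0.
Qed.

(** The points are the origin and, for each value [s] of [z], the indicator of the coordinates where
    [z] is at least [s]. *)
Lemma affine_dim_order_cone_ge z : (size (values z) <= affine_dim (order_cone z))%N.
Proof.
set c := size _.
pose s (l : 'I_c) := (values z)`_l.
pose x (i : 'I_c.+1) : 'rV[R]_k :=
  if unlift ord0 i is Some l then \row_r ((s l <= z 0 r)%R)%:R else 0.
apply: (@affine_dim_geq _ _ _ _ x); first exact: size_values.
- move=> b b0 bx.
  suff bl0 (l : 'I_c) : b (lift ord0 l) = 0.
    move=> i; case: (unliftP ord0 i) => [l ->|->]; first exact: bl0.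
    move: b0; rewrite big_ord_recl big1 ?addr0// => l _; exact: bl0.
  apply/eqP/negPn/negP => bl.
  (* Take the least value [s m] with nonzero coefficient: at a coordinate where [z] equals [s m],
     every other indicator vanishes or has coefficient [0]. *)
  case: (arg_minP (P := fun l => b (lift ord0 l) != 0) s bl) => m bm mmin.
  have : exists i, z 0 i = s m.
    have : s m \in values z by apply: mem_nth.
    by rewrite mem_undup => /mapP[i _ ->]; exists i.
  move=> [r zr].
  move/rowP/(_ r): bx; rewrite summxE big_ord_recl.
  rewrite /x unlift_none !mxE mulr0 add0r (bigD1 m)//= big1 ?addr0.
    by rewrite liftK !mxE zr lexx mulr1 => /eqP; rewrite (negbTE bm).
  move=> j jm; rewrite liftK !mxE zr.
  have [->|/mmin smj] := eqVneq (b (lift ord0 j)) 0; first by rewrite mul0r.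
  case: leP => [sjm|_]; last by rewrite mulr0.
  have /eqP : s m = s j by apply/eqP; rewrite eq_le smj.
  rewrite nth_uniq ?values_uniq// => /eqP/val_inj mj.
  by rewrite mj eqxx in jm.
- move=> i; rewrite /x; case: unliftP => [l _|_] r t zrt; rewrite !mxE//.
  by rewrite ler_nat; case: (leP (s l)) => // /le_trans->.
Qed.

(** A point of the cone is determined by its coordinates at one representative of each value of [z].
    The left kernel of the matrix of these coordinates, bordered by a column of ones, gives an
    affine dependency among more than [c + 1] points. *)
Lemma affine_dim_order_cone_le z : (affine_dim (order_cone z) <= size (values z))%N.
Proof.
set c := size _; set d := affine_dim _; rewrite leqNgt; apply/negP => cd.
have [x [xind xz]] := affine_dim_witness (leq_ltn_trans (leq0n c) cd).
have rep (l : 'I_c) : exists i, z 0 i = (values z)`_l.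
  have : (values z)`_l \in values z by apply: mem_nth.
  by rewrite mem_undup => /mapP[i _ ->]; exists i.
have [f fE] := choice rep.
pose N : 'M[R]_(d.+1, 1 + c) := row_mx (const_mx 1) (\matrix_(i, l) x i 0 (f l)).
have [|u u0] := exists_left_kernel N; first by rewrite add1n ltnS.
rewrite mul_mx_row -(row_mx0 R 1 1 c) => /eq_row_mx[u1 ux].
move/negP: u0; apply; apply/eqP/rowP => i; rewrite mxE.
apply: (xind (u 0)) => {i}.
  move/rowP/(_ 0): u1; rewrite !mxE; apply: etrans.
  by apply: eq_bigr => i _; rewrite mxE mulr1.
apply/rowP => r.
have rc : (index (z 0%R r) (values z) < c)%N by rewrite index_mem mem_values.
move/rowP/(_ (Ordinal rc)): ux; rewrite summxE !mxE; apply: etrans.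
apply: eq_bigr => i _; rewrite !mxE; congr (_ * _).
have zf : z 0 (f (Ordinal rc)) = z 0 r by rewrite fE nth_index ?mem_values.
by apply/eqP; rewrite eq_le !xz ?zf.
Qed.

Lemma affine_dim_order_cone z : affine_dim (order_cone z) = size (values z).
Proof.
by apply/eqP; rewrite eqn_leq affine_dim_order_cone_le affine_dim_order_cone_ge.
Qed.

(** Finitely many comparison patterns occur in [X]; one point for each exhibits [X] as a finite
    union of order cones. *)
Lemma polyhedral_dim_order_closed (X : set 'rV[R]_k) : X !=set0 ->
  (forall z, X z -> order_cone z `<=` X) ->
  (forall z, X z -> (size (values z) <= polyhedral_dim X)%N) /\
  exists2 z, X z & polyhedral_dim X = size (values z).
Proof.
move=> [z0 Xz0] Xcone.
pose pat z : {ffun 'I_k * 'I_k -> bool} := [ffun rt => z 0 rt.1 <= z 0 rt.2].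
pose I : finType := {v : {ffun 'I_k * 'I_k -> bool} | `[< exists2 z, X z & pat z = v >]}.
have zP (v : I) : exists z, X z /\ pat z = val v.
  by have /asboolP[z] := valP v; exists z.
have [f fP] := choice zP.
have fE z (Xz : X z) : exists v, order_cone (f v) z.
  have pz : `[< exists2 z', X z' & pat z' = pat z >] by apply/asboolP; exists z.
  exists (exist _ (pat z) pz : I) => r t.
  by have [_ /= /ffunP/(_ (r, t))] := fP (exist _ (pat z) pz); rewrite !ffunE /= => ->.
have XE : X = \bigcup_i order_cone (f i).
  apply/seteqP; split => [z /fE[v vz]|z [v _ vz]]; first by exists v.
  by apply: Xcone vz; have [] := fP v.
have dE : polyhedral_dim X = \max_i size (values (f i)).
  rewrite [in LHS]XE polyhedral_dim_bigcup => [|i]; last exact: order_cone_polyhedron.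
  by apply: eq_bigr => i _; exact: affine_dim_order_cone.
have I0 : (0 < #|{: I}|)%N.
  by have [v _] := fE _ Xz0; apply/card_gt0P; exists v.
split.
  move=> z Xz; rewrite dE.
  have pz : `[< exists2 z', X z' & pat z' = pat z >] by apply/asboolP; exists z.
  pose v : I := exist _ (pat z) pz.
  apply: leq_trans (leq_bigmax v).
  rewrite -!affine_dim_order_cone.
  have -> // : order_cone z = order_cone (f v).
  have [_ /= /ffunP vE] := fP v.
  by apply/seteqP; split => y yz r t; have := vE (r, t); rewrite !ffunE /= => E;
    have := yz r t; rewrite E.
rewrite dE; have [v ->] := bigop.eq_bigmax (fun i : I => size (values (f i))) I0.
by exists (f v) => //; have [] := fP v.
Qed.

End Cone.

(** * Solutions and paths *)

Section Placement.
Variable R : realFieldType.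
Implicit Types (A B S : seq R) (x y : R).

Lemma exists_gt_lt a B : (forall b, b \in B -> a < b) ->
  exists2 x, a < x & forall b, b \in B -> x < b.
Proof.
elim: B => [|b B IH] aB; first by exists (a + 1) => //; lra.
have [b' b'B|x ax xB] := IH; first by rewrite aB// inE b'B orbT.
have ab : a < b by rewrite aB// mem_head.
exists (Num.min x ((a + b) / 2)).
  by rewrite lt_min ax /=; lra.
move=> b'; rewrite inE gt_min => /predU1P[->|/xB->//].
by apply/orP; right; lra.
Qed.

Lemma exists_between A B :
  (forall a b, a \in A -> b \in B -> a < b) ->
  exists2 x, (forall a, a \in A -> a < x) & (forall b, b \in B -> x < b).
Proof.
elim: A => [|a A IH] AB.
  elim: B {AB} => [|b B [x _ xB]]; first by exists 0.
  exists (Num.min x (b - 1)) => // b'; rewrite inE gt_min.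
  by move=> /predU1P[->|/xB->//]; apply/orP; right; lra.
have [a' b a'A bB|x Ax xB] := IH; first by rewrite AB// inE a'A orbT.
have [ax|xa] := ltP a x.
  by exists x => // a'; rewrite inE => /predU1P[->|/Ax].
have [b bB|x' ax' x'B] := @exists_gt_lt a B; first by rewrite AB// mem_head.
exists x' => // a'; rewrite inE => /predU1P[->//|/Ax a'x].
by rewrite (lt_trans a'x)// (le_lt_trans xa).
Qed.

Lemma exists_between_notin A B S :
  (forall a b, a \in A -> b \in B -> a < b) ->
  exists x, [/\ forall a, a \in A -> a < x, forall b, b \in B -> x < b & x \notin S].
Proof.
move=> /exists_between[x0 Ax0 x0B].
(* An [x] above [x0] but below all elements of [S] that exceed [x0] lies outside [S]. *)
have [|x x0x xB] := @exists_gt_lt x0 (B ++ [seq s <- S | x0 < s]).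
  by move=> b; rewrite mem_cat mem_filter => /orP[/x0B//|/andP[]].
exists x; split.
- by move=> a /Ax0/lt_trans->.
- by move=> b bB; rewrite xB// mem_cat bB.
- apply/negP => xS; have := xB x; rewrite mem_cat mem_filter x0x xS orbT.
  by rewrite ltxx => /(_ isT).
Qed.

(** If [t] is some [y i], the answer is [u i]. Otherwise the [u i] to be kept below and those to be
    kept above leave an open gap, with room to avoid the finite [S]. *)
Lemma order_transfer (I : finType) (P : pred I) (y u : I -> R) (t : R) S :
  (forall i j, P i -> P j -> (y i <= y j) = (u i <= u j)) ->
  exists x, (forall i, P i -> (u i <= x) = (y i <= t) /\ (x <= u i) = (t <= y i))
    /\ ((forall i, P i -> y i != t) -> x \notin S).
Proof.
move=> yu; have [i /andP[Pi /eqP yit]|yt] := pickP (fun i => P i && (y i == t)).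
  exists (u i); split => [j Pj|/(_ _ Pi)/eqP//].
  by rewrite -yit !yu.
pose A := [seq u i | i <- enum I & P i && (y i < t)].
pose B := [seq u i | i <- enum I & P i && (t < y i)].
have [|x [Ax xB xS]] := @exists_between_notin A B S.
  move=> _ _ /mapP[i + ->] /mapP[j + ->].
  rewrite mem_filter => /andP[/andP[Pi it] _].
  rewrite mem_filter => /andP[/andP[Pj tj] _].
  by rewrite ltNge -yu// -ltNge (lt_trans it).
exists x; split => // i Pi.
have := yt i; rewrite Pi /= => /negbT; rewrite neq_lt => /orP[it|ti].
  have uix : u i < x by apply/Ax/map_f; rewrite mem_filter Pi it mem_enum.
  by rewrite (ltW uix) (ltW it) !leNgt uix it.
have xui : x < u i by apply/xB/map_f; rewrite mem_filter Pi ti mem_enum.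
by rewrite (ltW xui) (ltW ti) !leNgt xui ti.
Qed.

End Placement.

(** * Counting distinct values *)

Section NbValues.
Variable T : eqType.

Lemma size_undup_rcons (s : seq T) x :
  size (undup (rcons s x)) = (size (undup s) + (x \notin s))%N.
Proof.
have /perm_size -> : perm_eq (undup (rcons s x)) (undup (x :: s)).
  apply: uniq_perm; rewrite ?undup_uniq// => y.
  by rewrite !mem_undup mem_rcons.
by rewrite /=; case: (x \in s); rewrite ?addn0 ?addn1.
Qed.

Lemma size_undup_map_inj (I : eqType) (T' : eqType) (f : I -> T) (h : I -> T') s :
  (forall i j, i \in s -> j \in s -> (f i == f j) = (h i == h j)) ->
  size (undup (map f s)) = size (undup (map h s)).
Proof.
elim: s => [//|i s IH] fh /=.
have -> : (f i \in map f s) = (h i \in map h s).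
  apply/mapP/mapP => -[j js /eqP ij]; exists j => //; apply/eqP;
    by move: ij; rewrite fh ?mem_head// inE js orbT.
have E : size (undup (map f s)) = size (undup (map h s)).
  by apply: IH => j l js ls; rewrite fh// inE ?js ?ls orbT.
by case: ifP => //= _; rewrite E.
Qed.

Definition nb_values (f : nat -> T) m := size (undup (mkseq f m)).

Lemma nb_valuesS f m : nb_values f m.+1 = (nb_values f m + (f m \notin mkseq f m))%N.
Proof. by rewrite /nb_values mkseqS size_undup_rcons. Qed.

Lemma eq_nb_values f h m : (forall i, (i < m)%N -> f i = h i) ->
  nb_values f m = nb_values h m.
Proof.
move=> fh; congr (size (undup _)); apply/eq_in_map => i.
by rewrite mem_iota => /fh.
Qed.

End NbValues.

(** * Boolean recurrences as conditions on weak orders *)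

Section Boolean.
Variables (R : realType) (n : nat) (a : 'I_n.+1 -> \bar R).
Hypotheses (n_gt0 : (0 < n)%N) (a_bool : tropical_boolean a).
Implicit Types (f h : nat -> R) (v w : vertex R n).

Lemma eq_bigminP m (F : 'I_m -> \bar R) i :
  F i = \big[mine/+oo%E]_j F j <-> forall j, (F i <= F j)%E.
Proof.
split=> [-> j|Fi]; first exact: bigmin_le.
apply/eqP; rewrite eq_le bigmin_le andbT.
by apply: le_bigmin => //; exact: leey.
Qed.

Lemma bool_argminP m (b : 'I_m -> \bar R) (g : 'I_m -> R) i :
  (forall i, b i = 0%E \/ b i = +oo%E) -> (exists i, b i = 0%E) ->
  (b i + (g i)%:E = \big[mine/+oo%E]_j (b j + (g j)%:E))%E <->
  (b i = 0%E /\ forall j, b j = 0%E -> g i <= g j).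
Proof.
move=> b01 [i0 bi0]; rewrite (eq_bigminP (fun j => b j + (g j)%:E)%E).
split=> [min_i|[-> min_i] j].
  have bi : b i = 0%E.
    by case: (b01 i) => // bi; have := min_i i0; rewrite bi bi0 add0e.
  by split=> // j bj; have := min_i j; rewrite bi bj !add0e lee_fin.
case: (b01 j) => bj; rewrite bj add0e; first by rewrite add0e lee_fin min_i.
by rewrite addye// leey.
Qed.

(** The form of [min_attained_twice] that involves only comparisons of reals: infinite terms never
    reach the minimum. *)
Definition balanced (g : 'I_n.+1 -> R) : Prop :=
  exists i1 i2, [/\ i1 != i2, a i1 = 0%E, a i2 = 0%E, g i1 = g i2
                  & forall i, a i = 0%E -> g i1 <= g i].

Lemma min_attained_twiceP (g : 'I_n.+1 -> R) :
  min_attained_twice (fun i => (g i)%:E + a i)%E <-> balanced g.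
Proof.
have [a0 aN a01] := a_bool.
have -> : (fun i => (g i)%:E + a i)%E = (fun i => a i + (g i)%:E)%E.
  by apply/funext => i; rewrite addeC.
have P i := bool_argminP g i a01 (ex_intro _ ord0 a0).
split=> [[i1 [i2 [i12 /P[a1 g1] /P[a2 g2]]]]|[i1 [i2 [i12 a1 a2 g12 g1]]]].
  by exists i1, i2; split=> //; apply/eqP; rewrite eq_le g1// g2.
by exists i1, i2; split=> //; apply/P; split=> //; rewrite -g12.
Qed.

(** This is why the solution set contains the order cone of each of its points. *)
Lemma balanced_mono (g h : 'I_n.+1 -> R) :
  (forall r t, g r <= g t -> h r <= h t) -> balanced g -> balanced h.
Proof.
move=> gh [i1 [i2 [i12 a1 a2 g12 g1]]]; exists i1, i2; split=> //.
  by apply/eqP; rewrite eq_le !gh// g12.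
by move=> i /g1/gh.
Qed.

Lemma satisfiesP k (z : 'rV[R]_k) : satisfies a z <->
  forall j : 'I_(k - n), balanced (fun i => z 0 (window j i)).
Proof. by split=> H j; apply/min_attained_twiceP/H. Qed.

(** Functions on [nat] replace row vectors, so that windows and extensions need no dependent types;
    only the first [k] terms matter. *)
Definition solves f k : Prop :=
  forall j, (j + n < k)%N -> balanced (fun i => f (j + i)%N).

Definition row_of k f : 'rV[R]_k := \row_i f i.

Definition fun_of k (z : 'rV[R]_k) : nat -> R :=
  fun i => oapp (z 0) 0 (insub i).

Lemma fun_ofE k (z : 'rV[R]_k) (i : 'I_k) : fun_of z i = z 0 i.
Proof. by rewrite /fun_of valK. Qed.

Lemma fun_ofK k (z : 'rV[R]_k) : row_of k (fun_of z) = z.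
Proof. by apply/rowP => i; rewrite mxE fun_ofE. Qed.

Lemma satisfies_row_of k f : satisfies a (row_of k f) <-> solves f k.
Proof.
rewrite satisfiesP; split=> [fs j jk|fs j].
  have jk' : (j < k - n)%N by rewrite ltn_subRL addnC.
  by apply: balanced_mono (fs (Ordinal jk')) => r t; rewrite !mxE.
have jk : (j + n < k)%N by rewrite addnC -ltn_subRL.
by apply: balanced_mono (fs j jk) => r t; rewrite !mxE.
Qed.

Lemma size_values_row_of k f : size (values (row_of k f)) = nb_values f k.
Proof.
congr (size (undup _)); rewrite /mkseq -val_enum_ord -map_comp.
by apply: eq_map => i; rewrite /= mxE.
Qed.

Lemma solves_cst k : solves (fun=> 0) k.
Proof.
move=> j _; have [a0 aN _] := a_bool; exists ord0, ord_max; split=> //.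
by rewrite -val_eqE /= ltn_eqF.
Qed.

Lemma hilbert_values k :
  (forall f, solves f k -> (nb_values f k <= tropical_hilbert a k)%N)
  /\ exists2 f, solves f k & tropical_hilbert a k = nb_values f k.
Proof.
have [||dmax [z zs dz]] := @polyhedral_dim_order_closed R k [set z | satisfies a z].
- by exists (row_of k (fun=> 0)); apply/satisfies_row_of/solves_cst.
- move=> z /satisfiesP zs y zy; apply/satisfiesP => j.
  by apply: balanced_mono (zs j) => r t; exact: zy.
split=> [f fs|]; first by rewrite -size_values_row_of dmax//; exact/satisfies_row_of.
exists (fun_of z); first by apply/satisfies_row_of; rewrite fun_ofK.
by rewrite -size_values_row_of fun_ofK.
Qed.

(** * Windows of a sequence as vertices of the graph *)

Lemma vertex_of_subproof (y : 'rV[R]_n) :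
  `[< @order_cell R n [ffun rt => y 0 rt.1 <= y 0 rt.2] !=set0 >].
Proof. by apply/asboolP; exists y => r t; rewrite ffunE. Qed.

Definition vertex_of (y : 'rV[R]_n) : vertex R n :=
  exist _ [ffun rt => y 0 rt.1 <= y 0 rt.2] (vertex_of_subproof y).

Lemma cellP v (y : 'rV[R]_n) : cell v y <-> vertex_of y = v.
Proof.
split=> [vy|<- r t]; last by rewrite ffunE.
by apply/val_inj/ffunP => -[r t]; rewrite ffunE /= vy.
Qed.

Lemma cell_pointP v : vertex_of (cell_point v) = v.
Proof.
by apply/cellP; case/asboolP: (valP v) => y vy; apply: xgetPex; exists y.
Qed.

Definition vertex_at f j : vertex R n := vertex_of (\row_i f (j + i)%N).

Lemma vertex_atP f j h l : vertex_at f j = vertex_at h l <->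
  forall r t : 'I_n, (f (j + r)%N <= f (j + t)%N) = (h (l + r)%N <= h (l + t)%N).
Proof.
split=> [/(congr1 val)/ffunP fh r t|fh].
  by have := fh (r, t); rewrite !ffunE /= !mxE.
by apply/val_inj/ffunP => -[r t]; rewrite !ffunE /= !mxE.
Qed.

Lemma eq_vertex_at f h j : (forall i, (i < n)%N -> f (j + i)%N = h (j + i)%N) ->
  vertex_at f j = vertex_at h j.
Proof. by move=> fh; apply/vertex_atP => r t; rewrite !fh. Qed.

Lemma vertex_at_surj v : exists f, vertex_at f 0 = v.
Proof.
exists (fun_of (cell_point v)); rewrite -[RHS]cell_pointP; congr vertex_of.
by apply/rowP => i; rewrite mxE add0n fun_ofE.
Qed.

Lemma nb_distinct_vertex_at f : nb_distinct (vertex_at f 0) = nb_values f n.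
Proof.
rewrite /nb_values /mkseq -val_enum_ord -map_comp.
apply: size_undup_map_inj => i j _ _ /=.
have /(congr1 val)/ffunP E := cell_pointP (vertex_at f 0).
have Er r t : (cell_point (vertex_at f 0) 0 r <= cell_point (vertex_at f 0) 0 t)
    = (f r <= f t).
  by have := E (r, t); rewrite !ffunE /= !mxE.
by rewrite !eq_le !Er.
Qed.

Lemma edgeP v w : edge a v w <->
  exists f, [/\ vertex_at f 0 = v, vertex_at f 1 = w & balanced (fun i => f i)].
Proof.
have initE f : init_row (row_of n.+1 f) = \row_i f (0 + i)%N.
  by apply/rowP => i; rewrite !mxE.
have tailE f : tail_row (row_of n.+1 f) = \row_i f (1 + i)%N.
  by apply/rowP => i; rewrite !mxE.
have solve1 f : solves f n.+1 <-> balanced (fun i => f i).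
  split=> [/(_ 0 (ltnSn n))//|fb j]; rewrite -[X in (_ < X)%N]add1n ltn_add2r.
  by case: j.
split=> [/asboolP[y [+ + ys]]|[f [fv fw fb]]].
  rewrite -(fun_ofK y) initE tailE => /cellP fv /cellP fw.
  exists (fun_of y); split=> //.
  by apply/solve1/satisfies_row_of; rewrite fun_ofK.
apply/asboolP; exists (row_of n.+1 f); rewrite initE tailE; split.
- exact/cellP.
- exact/cellP.
- exact/satisfies_row_of/solve1.
Qed.

Lemma edge_at f j : balanced (fun i => f (j + i)%N) ->
  edge a (vertex_at f j) (vertex_at f j.+1).
Proof.
move=> fb; apply/edgeP; exists (fun i => f (j + i)%N); split=> //.
by apply/vertex_atP => r t; rewrite !addSnnS.
Qed.

(** Membership depends on the weak order alone, so the window of [f] can stand in for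
    [cell_point]. *)
Lemma min_setP f j (t : 'I_n) : t \in min_set a (vertex_at f j) <->
  (a (widen_ord (leqnSn n) t) = 0%E /\ forall s : 'I_n,
    a (widen_ord (leqnSn n) s) = 0%E -> f (j + t)%N <= f (j + s)%N).
Proof.
have [a0 _ a01] := a_bool; rewrite inE.
set y := cell_point _.
have /(congr1 val)/ffunP E := cell_pointP (vertex_at f j).
have Er r s : (y 0 r <= y 0 s) = (f (j + r)%N <= f (j + s)%N).
  by have := E (r, s); rewrite !ffunE /= !mxE.
have := @bool_argminP _ (fun s => a (widen_ord (leqnSn n) s)) (fun s => y 0 s) t.
case=> [s||P1 P2]; first exact: a01.
  by exists (Ordinal n_gt0); rewrite -[RHS]a0; congr a; exact: val_inj.
split=> [/eqP/P1[at0 min_t]|[at0 min_t]].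
  by split=> // s /min_t; rewrite Er.
by apply/eqP/P2; split=> // s /min_t; rewrite Er.
Qed.

Lemma ordS_cases (i : 'I_n.+1) :
  {i' : 'I_n | i = widen_ord (leqnSn n) i'} + {i = ord_max}.
Proof.
case: (unliftP ord_max i) => [i' ->|]; last by right.
by left; exists i'; apply: val_inj; exact: lift_max.
Qed.

(** A last term that is new cannot be one of two equal minimal terms; both then lie among the first
    [n], and [min_set] has two elements. *)
Lemma fresh_augmenting f j : balanced (fun i => f (j + i)%N) ->
  (forall i, (i < n)%N -> f (j + n)%N <> f (j + i)%N) ->
  augmenting a (vertex_at f j) (vertex_at f j.+1).
Proof.
move=> fb fresh; apply/and3P; split; first exact: edge_at.
  apply/eqP => S0; move: fb => [i1 [i2 [i12 a1 a2 f12 f1]]].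
  have [[i1' i1E]|i1E] := ordS_cases i1; have [[i2' i2E]|i2E] := ordS_cases i2.
  - have : i1' \in min_set a (vertex_at f j).
      by apply/min_setP; rewrite -i1E; split=> // s /f1; rewrite i1E.
    have : i2' \in min_set a (vertex_at f j).
      by apply/min_setP; rewrite -i2E; split=> // s /f1; rewrite f12 i2E.
    rewrite S0 !inE => /eqP i20 /eqP i10.
    by move: i12; rewrite i1E i2E -val_eqE /= i10 i20.
  - by apply: (fresh i1') => //; move: f12; rewrite i1E i2E /=.
  - by apply: (fresh i2') => //; move: f12; rewrite i1E i2E /=.
  - by rewrite i1E i2E eqxx in i12.
apply/asboolP => y yw t l tl ln ytl.
have /(congr1 val)/ffunP E : vertex_of y = vertex_at f j.+1 by apply/cellP.
have Er r s : (y 0 r <= y 0 s) = (f (j.+1 + r)%N <= f (j.+1 + s)%N).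
  by have := E (r, s); rewrite !ffunE /= !mxE.
have tn : (t.+1 < n)%N by move: tl; rewrite -ltnS => /leq_trans; apply; rewrite ln.
have jn : (j + n = j.+1 + l)%N by rewrite addSnnS ln.
apply: (fresh _ tn); rewrite jn -addSnnS.
by apply/eqP; rewrite eq_le -!Er ytl lexx.
Qed.

(** Term [j] leaves the window, so the incoming term is compared only with positions [1] to
    [n - 1]. *)
Lemma vertex_at_shift f h j : vertex_at f j = vertex_at h 0 ->
  (forall i, (0 < i < n)%N ->
    (f (j + i)%N <= f (j + n)%N) = (h i <= h n) /\
    (f (j + n)%N <= f (j + i)%N) = (h n <= h i)) ->
  vertex_at f j.+1 = vertex_at h 1.
Proof.
move=> /vertex_atP fh fhn; apply/vertex_atP => r t.
rewrite !addSnnS !add0n.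
have [rn|rn] := ltnP r.+1 n; have [tn|tn] := ltnP t.+1 n.
- exact: (fh (Ordinal rn) (Ordinal tn)).
- have -> : t.+1 = n by apply/eqP; rewrite eqn_leq tn andbT.
  by have [] := fhn r.+1 rn.
- have -> : r.+1 = n by apply/eqP; rewrite eqn_leq rn andbT.
  by have [] := fhn t.+1 tn.
- have -> : t.+1 = n by apply/eqP; rewrite eqn_leq tn andbT.
  have -> : r.+1 = n by apply/eqP; rewrite eqn_leq rn andbT.
  by rewrite !lexx.
Qed.

(** The edge provides some realization [y]; [order_transfer] carries its last term over to the
    window of [f]. Quantifying over [h] makes the result apply to any sequence that continues this
    window by [x]. *)
Lemma edge_extend f j w : edge a (vertex_at f j) w ->
  exists x, forall h, (forall i, (i < n)%N -> h (j + i)%N = f (j + i)%N) ->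
    h (j + n)%N = x ->
    balanced (fun i => h (j + i)%N) /\ vertex_at h j.+1 = w.
Proof.
move=> /edgeP[y [yf <- yb]].
have [|x [xy _]] := @order_transfer R 'I_n predT (fun i => y i)
  (fun i => f (j + i)%N) (y n) [::].
  by move=> r t _ _; move/vertex_atP: yf => ->.
exists x => h hf hx.
have hy : vertex_at h j = vertex_at y 0.
  by rewrite yf; apply: eq_vertex_at => i /hf.
have hyn i : (i < n)%N -> (h (j + i)%N <= h (j + n)%N) = (y i <= y n) /\
    (h (j + n)%N <= h (j + i)%N) = (y n <= y i).
  by move=> i_n; rewrite hf// hx; exact: (xy (Ordinal i_n)).
split; last by apply: vertex_at_shift => // i /andP[_ /hyn].
apply: balanced_mono yb => r t.
have [[r' ->]|->] := ordS_cases r; have [[t' ->]|->] := ordS_cases t => /=.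
- by move/vertex_atP: hy => ->.
- by have [->] := hyn r' (ltn_ord r').
- by have [_ ->] := hyn t' (ltn_ord t').
- by rewrite !lexx.
Qed.

(* On an augmenting edge the window already has two minimal terms among its
   first n, one of them at a positive index; hence the last term may be moved
   freely above y_0, the only earlier term it is not compared with in w. *)
Lemma augmenting_extend f j w (S : seq R) : augmenting a (vertex_at f j) w ->
  exists2 x, x \notin S &
    forall h, (forall i, (i < n)%N -> h (j + i)%N = f (j + i)%N) ->
    h (j + n)%N = x ->
    balanced (fun i => h (j + i)%N) /\ vertex_at h j.+1 = w.
Proof.
move=> /and3P[/edgeP[y [yf yw yb]] Sv /asboolP wnew].
have yn i : (0 < i < n)%N -> y i != y n.
  case: i => // i /= i_n; apply/eqP => yin.
  have /cellP/wnew : vertex_of (\row_i y (1 + i)%N) = w by [].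
  have n1 : (n.-1 < n)%N by rewrite prednK.
  move=> /(_ (Ordinal (ltnW i_n)) (Ordinal n1)) /=.
  rewrite !mxE /= !add1n prednK//; case=> //.
  by rewrite -ltnS prednK.
have [i1 [i2 [i12 Si1 Si2 i1_gt0 yi1]]] : exists i1 i2 : 'I_n, [/\ i1 != i2,
    i1 \in min_set a (vertex_at f j), i2 \in min_set a (vertex_at f j),
    (0 < i1)%N & y i1 <= y n].
  rewrite -yf in Sv *.
  move: yb => [i1 [i2 []]].
  wlog : i1 i2 / (i1 <= i2)%N.
    move=> W; case: (leqP i1 i2) => [/W//|/ltnW/W{}W i12 a1 a2 y12 y1].
    by apply: W => //; [rewrite eq_sym|rewrite -y12].
  move=> + i12 a1 a2 y12 y1.
  have [[i1' i1E]|i1E] := ordS_cases i1; last first.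
    rewrite i1E /= => ni2; move: i12; rewrite i1E -val_eqE /= eq_sym.
    by rewrite eqn_leq -ltnS ltn_ord ni2.
  have S1 : i1' \in min_set a (vertex_at y 0).
    by apply/min_setP; rewrite -i1E; split=> // s /y1; rewrite i1E.
  have [[i2' i2E] i12'|i2E _] := ordS_cases i2.
    exists i2', i1'; split=> //.
    - by move: i12; rewrite i1E i2E -!val_eqE eq_sym.
    - by apply/min_setP; rewrite -i2E; split=> // s /y1; rewrite y12 i2E.
    - by move: i12 i12'; rewrite i1E i2E -!val_eqE /=; case: (i2' : nat) => //;
        case: (i1' : nat).
    - have [_ aN _] := a_bool.
      by move: (y1 _ aN); rewrite y12 i2E.
  (* Here the last term is one of the two minimal ones. As it differs from the terms at positive
     indices, the other has index [0], and [min_set] would be [{0}]. *)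
  exfalso; move/negP: Sv; apply; apply/eqP/setP => t; rewrite [RHS]inE.
  have y1n : y i1' = y n by move: y12; rewrite i1E i2E.
  have i1'0 : (i1' : nat) = 0%N.
    apply/eqP; rewrite -leqn0 leqNgt; apply/negP => i1'_gt0.
    by have := yn i1'; rewrite i1'_gt0 ltn_ord y1n eqxx => /(_ isT).
  have [t0|t0] := eqVneq (t : nat) 0%N.
    by have -> : t = i1' by apply: val_inj; rewrite /= t0 i1'0.
  apply/negP => /min_setP[at0 yt].
  have /min_setP[a10 y1'] := S1.
  have : y t = y n.
    by rewrite -y1n; apply/eqP; rewrite eq_le; apply/andP; split; [exact: yt|exact: y1'].
  by apply/eqP/yn; rewrite ltn_ord lt0n t0.
have [|x [xy xS]] := @order_transfer R 'I_n [pred i : 'I_n | 0 < i]%N (fun i => y i)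
  (fun i => f (j + i)%N) (y n) S.
  by move=> r t _ _; move/vertex_atP: yf => ->.
exists x; first by apply: xS => i i0; rewrite yn// ltn_ord andbT.
move=> h hf hx.
have hy : vertex_at h j = vertex_at y 0.
  by rewrite yf; apply: eq_vertex_at => i /hf.
have hfj : vertex_at f j = vertex_at h j by rewrite hy.
have hyn i : (0 < i < n)%N -> (h (j + i)%N <= h (j + n)%N) = (y i <= y n) /\
    (h (j + n)%N <= h (j + i)%N) = (y n <= y i).
  by move=> /andP[i0 i_n]; rewrite hf// hx; exact: (xy (Ordinal i_n)).
split; last by rewrite -yw; exact: vertex_at_shift.
rewrite hfj in Si1 Si2.
have /min_setP[a1 h1] := Si1; have /min_setP[a2 h2] := Si2.
exists (widen_ord (leqnSn n) i1), (widen_ord (leqnSn n) i2); split=> //.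
  by apply/eqP; rewrite eq_le h1// h2.
move=> i; have [[i' ->]|-> _ /=] := ordS_cases i; first exact: h1.
by have [] := hyn i1; rewrite ?i1_gt0 ?ltn_ord// => ->.
Qed.

(** Each edge appends one term, taken outside all earlier values when the edge is augmenting. *)
Lemma path_realization v p : path (edge a) v p ->
  exists f, [/\ forall j, (j < size p)%N -> balanced (fun i => f (j + i)%N),
    vertex_at f (size p) = last v p &
    (nb_distinct v + path_augmenting a v p <= nb_values f (size p + n))%N].
Proof.
elim/last_ind: p => [_|p w IH].
  have [f fv] := vertex_at_surj v; exists f; split=> //.
  by rewrite /path_augmenting /= addn0 -fv nb_distinct_vertex_at.
rewrite rcons_path => /andP[/IH{IH}[f [fb flast fnb]] pw].
rewrite -[path_augmenting _ _ _]/(walk_count _ _ _) walk_count_rcons size_rcons.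
rewrite last_rcons addSn.
have [x xh xfresh] : exists2 x,
    forall h, (forall i, (i < n)%N -> h (size p + i)%N = f (size p + i)%N) ->
      h (size p + n)%N = x ->
      balanced (fun i => h (size p + i)%N) /\ vertex_at h (size p).+1 = w
    & augmenting a (last v p) w -> x \notin mkseq f (size p + n).
  case: (boolP (augmenting a (last v p) w)) => [|_]; rewrite -flast in pw *.
    by move=> /(augmenting_extend (mkseq f (size p + n)))[x]; exists x.
  by have [x] := edge_extend pw; exists x.
pose h i := if (i < size p + n)%N then f i else x.
have hf i : (i < size p + n)%N -> h i = f i by rewrite /h => ->.
have hx : h (size p + n)%N = x by rewrite /h ltnn.
have hfp i : (i < n)%N -> h (size p + i)%N = f (size p + i)%N.
  by move=> i_n; rewrite hf// ltn_add2l.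
have [hb hw] := xh h hfp hx.
exists h; split=> //.
  move=> j; rewrite ltnS leq_eqVlt => /predU1P[->//|jp].
  apply: balanced_mono (fb _ jp) => r t.
  by rewrite !hf// -addSn leq_add// -ltnS.
rewrite nb_valuesS (eq_nb_values hf) addnA leq_add// hx.
have -> : mkseq h (size p + n) = mkseq f (size p + n).
  by apply/eq_in_map => i; rewrite mem_iota => /hf.
by case: (augmenting _ _ _) xfresh => // /(_ isT) ->.
Qed.

Lemma path_le_hilbert v p : path (edge a) v p ->
  (nb_distinct v + path_augmenting a v p <= tropical_hilbert a (size p + n))%N.
Proof.
move=> /path_realization[f [fb _ fnb]]; apply: leq_trans fnb _.
have [dmax _] := hilbert_values (size p + n).
by apply: dmax => j; rewrite ltn_add2r; exact: fb.
Qed.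

(** The path consists of the windows of a solution with the most distinct values: a term new among
    all earlier ones is new in its window, so its edge is augmenting. Equality follows from
    [path_le_hilbert]. *)
Lemma hilbert_path l : exists v p, [/\ path (edge a) v p, size p = l &
  tropical_hilbert a (l + n) = (nb_distinct v + path_augmenting a v p)%N].
Proof.
have [_ [f fs dE]] := hilbert_values (l + n).
pose p m := mkseq (fun j => vertex_at f j.+1) m.
have lastE m : last (vertex_at f 0) (p m) = vertex_at f m.
  by case: m => // m; rewrite /p mkseqS last_rcons.
have pP m : (m <= l)%N -> path (edge a) (vertex_at f 0) (p m) /\
    (nb_values f (m + n) <=
     nb_distinct (vertex_at f 0) + path_augmenting a (vertex_at f 0) (p m))%N.
  elim: m => [_|m IH ml]; first by rewrite nb_distinct_vertex_at leq_addr.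
  have [pm nm] := IH (ltnW ml).
  have fb : balanced (fun i => f (m + i)%N) by apply: fs; rewrite ltn_add2r.
  rewrite /p mkseqS -/(p m) rcons_path lastE pm edge_at//; split=> //.
  rewrite -[path_augmenting _ _ _]/(walk_count _ _ _) walk_count_rcons lastE.
  rewrite addSn nb_valuesS addnA leq_add//.
  case: (boolP (f (m + n)%N \in _)) => // fresh; rewrite fresh_augmenting//.
  move=> i i_n fi; move/negP: fresh; apply; rewrite fi.
  by apply/mapP; exists (m + i)%N => //; rewrite mem_iota /= ltn_add2l.
have [pl nl] := pP l (leqnn l).
exists (vertex_at f 0), (p l); split=> //; first by rewrite size_mkseq.
apply/eqP; rewrite eqn_leq {1}dE nl /=.
by have := path_le_hilbert pl; rewrite size_mkseq.
Qed.

End Boolean.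

(** * The maximal ratio *)

Section Ratio.
Variables (R : realType) (n : nat) (a : 'I_n.+1 -> \bar R).
Hypotheses (n_gt0 : (0 < n)%N) (a_bool : tropical_boolean a).
Implicit Types (u v w : vertex R n) (p q c : seq (vertex R n)).

Local Notation d := (tropical_hilbert a).
Local Notation H := (max_ratio a).
Local Notation V := #|{: vertex R n}|.
Local Notation L := (optimal_period a).

Lemma simple_cycle_size c : simple_cycle a c -> (0 < size c <= V)%N.
Proof.
move=> /and3P[c0 _ /card_uniqP cE].
by rewrite lt0n size_eq0 c0 -cE max_card.
Qed.

Lemma cycle_ratio_ge0 c : 0 <= cycle_ratio a c.
Proof. by rewrite /cycle_ratio divr_ge0. Qed.

Lemma cycle_ratio_le c : simple_cycle a c -> cycle_ratio a c <= H.
Proof.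
move=> c_simple; have /andP[_ cV] := simple_cycle_size c_simple.
by apply: (@le_bigmax_cond _ _ _ _ (Bseq cV)).
Qed.

Lemma card_vertex_gt0 : (0 < V)%N.
Proof. by apply/card_gt0P; exists (vertex_of 0). Qed.

(** A path of length [V], traced by a solution with [V + n] terms, must repeat a vertex. *)
Lemma exists_simple_cycle : exists c, simple_cycle a c.
Proof.
have [v [p [vp sp _]]] := hilbert_path n_gt0 a_bool V.
have : ~~ uniq (v :: p).
  apply/negP => /card_uniqP; rewrite /= sp => Vlt.
  by have := max_card (mem (v :: p)); rewrite Vlt ltnn.
move=> /nonuniq_walk_split[p1 [u [q [p2 [pE lu uq]]]]].
move: vp; rewrite pE !cat_path lu => /and3P[_ uqu _].
by exists (u :: q); apply/and3P.
Qed.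

Lemma exists_optimal_cycle : exists c, optimal_cycle a c.
Proof.
have [c0 c0_simple] := exists_simple_cycle.
have /andP[_ c0V] := simple_cycle_size c0_simple.
have [c c_simple Hc] := @eq_bigmax _ _ _ 0 (Bseq c0V : {bseq V of vertex R n})
  (fun c : {bseq V of vertex R n} => simple_cycle a c)
  (fun c : {bseq V of vertex R n} => cycle_ratio a c) c0_simple
  (fun (c : {bseq V of vertex R n}) _ => cycle_ratio_ge0 c).
by exists c; apply/andP; split=> //; apply/eqP; rewrite /max_ratio Hc.
Qed.

Lemma simple_cycle_count c : simple_cycle a c ->
  (cycle_augmenting a c)%:R <= H * (size c)%:R.
Proof.
move=> c_simple; have /andP[c0 _] := simple_cycle_size c_simple.
by rewrite -ler_pdivrMr ?ltr0n// cycle_ratio_le.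
Qed.

Lemma optimal_cycle_count c : optimal_cycle a c ->
  (cycle_augmenting a c)%:R = H * (size c)%:R.
Proof.
move=> /andP[/simple_cycle_size/andP[c0 _] /eqP <-].
by rewrite divfK// pnatr_eq0 -lt0n.
Qed.

(* Two distinct fractions with denominators at most V differ by at least
   1 / V^2. *)
Lemma nonoptimal_cycle_count c : simple_cycle a c -> ~~ optimal_cycle a c ->
  (cycle_augmenting a c)%:R <= (H - (V%:R ^+ 2)^-1) * (size c)%:R.
Proof.
move=> c_simple; rewrite /optimal_cycle c_simple /= => cH.
have /andP[c0 cV] := simple_cycle_size c_simple.
have [b b_opt] := exists_optimal_cycle; have Hb := optimal_cycle_count b_opt.
have /andP[b0 bV] := simple_cycle_size (andP b_opt).1.
have ltH : cycle_ratio a c < H by rewrite lt_neqAle cH cycle_ratio_le.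
move: ltH; rewrite /cycle_ratio ltr_pdivrMr ?ltr0n// => ltH.
(* With [H] written as the ratio of the optimal cycle [b], cross-multiplication compares integers,
   so the gap is at least [1]. *)
have lt1 : (cycle_augmenting a c * size b + 1 <= cycle_augmenting a b * size c)%N.
  rewrite addn1 -(ltr_nat R) !natrM Hb mulrAC ltr_pM2r// ltr0n//.
move: lt1; rewrite -(ler_nat R) natrD !natrM Hb => lt1.
rewrite -(ler_pM2r (_ : 0 < (size b)%:R)) ?ltr0n//.
have VV : (size b)%:R * (size c)%:R <= V%:R ^+ 2 :> R.
  by rewrite expr2 ler_pM// ler_nat.
have : (V%:R ^+ 2)^-1 * ((size b)%:R * (size c)%:R) <= 1 :> R.
  by rewrite ler_pdivrMl ?mulr1// exprn_gt0// ltr0n card_vertex_gt0.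
lra.
Qed.

Lemma max_ratio_ge0 : 0 <= H.
Proof.
have [c /andP[_ /eqP <-]] := exists_optimal_cycle; exact: cycle_ratio_ge0.
Qed.

Lemma max_ratio_le1 : H <= 1.
Proof.
have [c c_opt] := exists_optimal_cycle.
have /andP[c0 _] := simple_cycle_size (andP c_opt).1.
rewrite -(ler_pM2r (_ : 0 < (size c)%:R)) ?ltr0n// mul1r.
rewrite -optimal_cycle_count// ler_nat (leq_trans (count_size _ _))//.
by rewrite size_zip geq_minl.
Qed.

Lemma walk_simple_le u q : cycle (edge a) (u :: q) -> uniq (u :: q) ->
  (walk_count (augmenting a) u (rcons q u))%:R <= H * (size q).+1%:R.
Proof.
move=> eq uq; rewrite -cycle_count_cons.
by apply: (@simple_cycle_count (u :: q)); apply/and3P.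
Qed.

(** * Linear bounds on the Hilbert function and its entropy *)

Lemma nb_distinct_le v : (nb_distinct v <= n)%N.
Proof. by rewrite (leq_trans (size_undup _))// size_map size_enum_ord. Qed.

(** For [n <= k], winding [l = k - n] times around an optimal cycle [c] gives a walk that also
    splits into [size c] blocks of length [l], each with at most [d k] augmenting edges. Counting
    both ways leaves no error term. *)
Lemma hilbert_lower k : H * (k%:R - n%:R) <= (d k)%:R.
Proof.
have [kn|nk] := ltnP k n.
  apply: (@le_trans _ _ 0) => //; rewrite mulr_ge0_le0 ?max_ratio_ge0//.
  by rewrite subr_le0 ler_nat ltnW.
rewrite -(subnK nk) natrD addrK; set l := (k - n)%N.
have [c c_opt] := exists_optimal_cycle.
have /and3P[_ ec _] := (andP c_opt).1.
have /andP[c0 _] := simple_cycle_size (andP c_opt).1.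
have [u uc] : exists u, u \in c.
  by case: c c0 {c_opt ec} => // u c _; exists u; rewrite mem_head.
have [q [uq cq sq]] := cycle_unroll (augmenting a) uc ec.
have [lq _ lcount] := wind_closed (augmenting a) l uq (last_rcons _ _ _).
have sl : size (wind l (rcons q u)) = (size c * l)%N.
  by rewrite size_wind size_rcons sq mulnC.
have Bl v p : path (edge a) v p -> size p = l ->
    (walk_count (augmenting a) v p <= d (l + n))%N.
  move=> /(path_le_hilbert n_gt0 a_bool) + sp; rewrite sp.
  by apply: leq_trans; rewrite leq_addl.
have := walk_count_le_mul Bl lq sl.
rewrite lcount cq -(ler_nat R) !natrM.
have -> : (cycle_count (augmenting a) c)%:R = H * (size c)%:R.
  exact: optimal_cycle_count.
by rewrite mulrA [leRHS]mulrC ler_pM2r ?ltr0n// mulrC.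
Qed.

(** For [n <= k], the reduced walk bounds the augmenting edges and [nb_distinct] adds at most [n];
    for [k < n], the bound [d k <= k] suffices. *)
Lemma hilbert_upper k :
  (d k)%:R <= H * k%:R + (1 - H) * (V + n)%:R.
Proof.
have H1 := max_ratio_le1.
have [kn|nk] := ltnP k n.
  have dk : (d k)%:R <= k%:R :> R.
    rewrite ler_nat; have [_ [f _ ->]] := hilbert_values n_gt0 a_bool k.
    by rewrite (leq_trans (size_undup _))// size_mkseq.
  apply: le_trans dk _; rewrite -lerBlDl -[X in X - _]mul1r -mulrBl.
  by rewrite ler_wpM2l ?subr_ge0// ler_nat (leq_trans (ltnW kn))// leq_addl.
have [v [p [vp sp]]] := hilbert_path n_gt0 a_bool (k - n).
rewrite subnK// => ->; rewrite -[path_augmenting _ _ _]/(walk_count _ _ _).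
have := @walk_count_le _ _ (augmenting a) R H predT (fun u q _ => @walk_simple_le u q) v p
  H1 vp (fun _ _ => isT).
rewrite sp natrB// !natrD.
have : (nb_distinct v)%:R <= n%:R :> R by rewrite ler_nat nb_distinct_le.
have : (1 - H) * V.-1%:R <= (1 - H) * V%:R.
  by rewrite ler_wpM2l ?subr_ge0// ler_nat leq_pred.
lra.
Qed.

Lemma hilbert_quotient_cvg : hilbert_quotient a @ \oo --> H.
Proof.
apply/cvgrPdist_le => e e0; near=> k.
have k0 : 0 < k%:R :> R by near: k; exact: nbhs_infty_gtr.
(* One threshold for both sides: the sum of the error constants of the two bounds, divided by
   [e]. *)
have kC : (H * n%:R + (1 - H) * (V + n)%:R) / e <= k%:R.
  by near: k; exact: nbhs_infty_ger.
move: kC; rewrite ler_pdivrMr// => kC.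
have H0 : 0 <= H * n%:R by rewrite mulr_ge0// max_ratio_ge0.
have C0 : 0 <= (1 - H) * (V + n)%:R by rewrite mulr_ge0// subr_ge0 max_ratio_le1.
have lo := hilbert_lower k; have up := hilbert_upper k.
have q_lo : H - e <= hilbert_quotient a k by rewrite ler_pdivlMr//; lra.
have q_up : hilbert_quotient a k <= H + e by rewrite ler_pdivrMr//; lra.
by rewrite ler_norml; apply/andP; split; lra.
Unshelve. all: by end_near. Qed.

(** Otherwise every simple cycle on the vertices of the path has ratio at most [H - x] with
    [x = 1 / V^2], and over so many edges this deficit contradicts [hilbert_lower]. *)
Lemma long_path_meets_optimal k v p :
  path (edge a) v p -> (size p + n = k)%N ->
  (V ^ 2 * (V + n) + V < size p)%N ->
  (nb_distinct v + path_augmenting a v p = d k)%N ->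
  exists2 c, optimal_cycle a c & exists2 u, u \in v :: p & u \in c.
Proof.
move=> vp sp long vd; apply: contrapT => no_opt.
have V0 : 0 < V%:R :> R by rewrite ltr0n card_vertex_gt0.
pose x : R := (V%:R ^+ 2)^-1; have x0 : 0 < x by rewrite invr_gt0 exprn_gt0.
have H1 := max_ratio_le1; have H0 := max_ratio_ge0.
have : (walk_count (augmenting a) v p)%:R
    <= (H - x) * (size p)%:R + (1 - (H - x)) * V.-1%:R.
  apply: (@walk_count_le _ (edge a) _ R _ (mem (v :: p))) => //; last by lra.
  move=> u q qp eq uq; rewrite -cycle_count_cons.
  apply: (@nonoptimal_cycle_count (u :: q)); first exact/and3P.
  apply/negP => q_opt; apply: no_opt; exists (u :: q) => //.
  by exists u; [apply: qp|]; rewrite mem_head.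
have := hilbert_lower k; rewrite -vd -sp !natrD.
rewrite -[path_augmenting _ _ _]/(walk_count _ _ _).
have : (nb_distinct v)%:R <= n%:R :> R by rewrite ler_nat nb_distinct_le.
have : (V.-1)%:R + 1 = V%:R :> R by rewrite natr1 prednK// card_vertex_gt0.
move: long; rewrite -(ltr_nat R) natrD natrM natrX natrD.
set l := (size p)%:R; set W : R := V%:R; set W' : R := V.-1%:R.
set N : R := n%:R; set c : R := (walk_count _ _ _)%:R; set b : R := (nb_distinct v)%:R.
move=> long W'E bN lo count_le.
have W'0 : 0 <= W' by [].
(* Scaled by [x], the length bound becomes [V + n + x V], more than the [n + (1 - H + x)(V - 1)]
   allowed by the two estimates. *)
have xl : x * (W ^+ 2 * (W + N) + W) < x * l by rewrite ltr_pM2l.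
have xW : x * W ^+ 2 = 1 by rewrite mulVf// expf_neq0// gt_eqF.
have xE : x * (W ^+ 2 * (W + N) + W) = W + N + x * W.
  by rewrite mulrDr mulrA xW mul1r.
rewrite xE in xl.
have HW : 0 <= H * W' by rewrite mulr_ge0.
have xW' : x * W' <= x * W by rewrite ler_pM2l//; lra.
clear sp vd; lra.
Qed.

(** * Growth along multiples of the optimal period *)

Lemma optimal_period_gt0 : (0 < L)%N.
Proof.
apply: (big_ind (fun m => (0 < m)%N)) => [//|x y x0 y0|c].
  by rewrite lcmn_gt0 x0.
by move=> /andP[/simple_cycle_size/andP[]].
Qed.

(** A path realizing [d k] meets an optimal cycle [c]; winding [L / size c] times around it there
    adds [L] edges, of which [H L] are augmenting. *)
Lemma hilbert_period_ge k : ((V ^ 2 + 1) * (V + n) < k)%N ->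
  (d k)%:R + H * L%:R <= (d (k + L)%N)%:R.
Proof.
move=> k_large.
have nk : (n <= k)%N by rewrite ltnW// (leq_ltn_trans _ k_large)// mulnDl; lia.
have [v [p [vp sp]]] := hilbert_path n_gt0 a_bool (k - n).
rewrite subnK// => dk.
have spk : (size p + n)%N = k by rewrite sp subnK.
have [|c c_opt [u up uc]] := long_path_meets_optimal vp spk _ (esym dk).
  by rewrite -(ltn_add2r n) spk; apply: leq_ltn_trans k_large; lia.
have [c_simple _] := andP c_opt.
have /and3P[_ ec _] := c_simple; have /andP[_ cV] := simple_cycle_size c_simple.
have [q [uq cq sq]] := cycle_unroll (augmenting a) uc ec.
have /dvdnP[m mE] : (size c %| L)%N by apply: (@biglcmn_sup _ (Bseq cV)).
have [mq lq mcount] := wind_closed (augmenting a) m uq (last_rcons _ _ _).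
case/splitPl: up vp dk spk sp => p1 p2 lp1; rewrite cat_path lp1 => /andP[vp1 up2].
move=> dk spk _.
have vp' : path (edge a) v (p1 ++ wind m (rcons q u) ++ p2).
  by rewrite !cat_path vp1 lp1 mq lq.
have := path_le_hilbert n_gt0 a_bool vp'.
rewrite dk -[path_augmenting _ _ _]/(walk_count _ _ _).
rewrite -[path_augmenting _ v (p1 ++ p2)]/(walk_count _ _ _).
rewrite !walk_count_cat lp1 lq mcount cq !size_cat size_wind size_rcons sq -mE.
have -> : (size p1 + (L + size p2) + n)%N = (k + L)%N.
  by rewrite -spk size_cat [(L + _)%N]addnC addnA addnAC.
rewrite -(ler_nat R) !natrD natrM.
have -> : (cycle_count (augmenting a) c)%:R = H * (size c)%:R.
  exact: optimal_cycle_count.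
rewrite mE natrM; lra.
Qed.

(** A path realizing [d (l + n)] contains a closed walk of length [i L], whose removal costs at most
    [H i L] augmenting edges. *)
Lemma hilbert_period_excise l : (V * L <= l)%N ->
  exists2 i, (0 < i <= V)%N & (i * L <= l)%N /\
    (d (l + n))%:R <= (d (l - i * L + n)%N)%:R + H * i%:R * L%:R.
Proof.
have [v [p [vp <- dl]]] := hilbert_path n_gt0 a_bool l => Vl.
have [p1 [c [p2 [pE lc [i iV sc]]]]] := long_walk_split v optimal_period_gt0 Vl.
have sp : size p = (size (p1 ++ p2) + i * L)%N by 
  rewrite pE !size_cat sc [(i * L + _)%N]addnC addnA.
exists i => //; split; first by rewrite sp leq_addl.
move: vp; rewrite dl {1}pE !cat_path lc => /and3P[vp1 ec up2].
have vp' : path (edge a) v (p1 ++ p2) by rewrite cat_path vp1 up2.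
have := path_le_hilbert n_gt0 a_bool vp'.
rewrite sp addnK -[path_augmenting _ _ _]/(walk_count _ _ _).
rewrite -[path_augmenting _ v p]/(walk_count _ _ _).
rewrite pE !walk_count_cat lc -(ler_nat R).
have := @closed_walk_count_le _ _ (augmenting a) R H predT
  (fun u q _ => @walk_simple_le u q) _ _ ec lc (fun _ _ => isT).
rewrite sc natrM !natrD; lra.
Qed.

(** Strong induction beyond [V]: excision leads from [j] back to some [j - i], which gives the upper
    bound, and [hilbert_period_ge] from [j - 1] gives the lower one. *)
Lemma hilbert_period_eq k : ((V ^ 2 + 1) * (V + n) < k)%N ->
  (forall i, (i <= V)%N -> (d (k + i * L)%N)%:R = (d k)%:R + H * i%:R * L%:R) ->
  forall j, (d (k + j * L)%N)%:R = (d k)%:R + H * j%:R * L%:R.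
Proof.
move=> k_large init; elim/ltn_ind => j IH.
have [/init//|Vj] := leqP j V.
have nk : (n <= k)%N by rewrite ltnW// (leq_ltn_trans _ k_large)// mulnDl; lia.
apply/eqP; rewrite eq_le; apply/andP; split.
  have VL : (V * L <= k + j * L - n)%N.
    by rewrite -addnBAC// (leq_trans _ (leq_addl _ _))// leq_mul2r ltnW ?orbT.
  have [i /andP[i0 iV] [_]] := hilbert_period_excise VL.
  have ij : (i <= j)%N by rewrite (leq_trans iV)// ltnW.
  have -> : (k + j * L - n - i * L + n = k + (j - i) * L)%N.
    have : (i * L <= j * L)%N by rewrite leq_mul2r ij orbT.
    by rewrite mulnBl; lia.
  rewrite subnK; last by lia.
  rewrite IH ?ltn_subrL ?i0 ?(leq_ltn_trans _ Vj)// natrB//; lra.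
case: j Vj IH => // j _ IH.
have := hilbert_period_ge (ltn_addr (j * L) k_large).
have -> : (k + j * L + L = k + j.+1 * L)%N by rewrite mulSn addnCA addnC.
rewrite IH// -natr1; lra.
Qed.

End Ratio.

Theorem corollary6p7 (R : realType) (n : nat) (n_gt0 : (0 < n)%N)
    (a : 'I_n.+1 -> \bar R) (a_bool : tropical_boolean a) :
  let d := tropical_hilbert a in
  let H := tropical_entropy a in
  let calH := max_ratio a in
  let V := #|{: vertex R n}| in
  let L := optimal_period a in
  [/\ (* (a) *)
      forall k : nat, (d k)%:R >= calH * (k%:R - n%:R),
      (* (b) *)
      forall k : nat, (d k)%:R <= calH * k%:R + (1 - calH) * (V + n)%:R,
      (* (c) *)
      cvgn (hilbert_quotient a) /\ calH = H &
   [/\ (* (d) *)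
      forall (k : nat) (v : vertex R n) (p : seq (vertex R n)),
        path (edge a) v p -> (size p + n = k)%N ->
        (V ^ 2 * (V + n) + V < size p)%N ->
        (nb_distinct v + path_augmenting a v p = d k)%N ->
        exists2 c, optimal_cycle a c & exists2 u, u \in v :: p & u \in c,
      (* (e) *)
      forall k : nat, ((V ^ 2 + 1) * (V + n) < k)%N ->
        (d (k + L)%N)%:R >= (d k)%:R + H * L%:R
      & (* (f) *)
      forall k : nat, ((V ^ 2 + 1) * (V + n) < k)%N ->
        (forall i : nat, i%:R <= V%:R * ((1 - H) * V%:R + n%:R + 1) ->
          (d (k + i * L)%N)%:R = (d k)%:R + H * i%:R * L%:R) ->
        forall j : nat, (d (k + j * L)%N)%:R = (d k)%:R + H * j%:R * L%:R]].
Proof.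
move=> d H calH V L.
have cvgH := hilbert_quotient_cvg n_gt0 a_bool.
(* Uniqueness of the limit gives (c) and reduces (e) and (f) to statements about [calH]. *)
have HE : H = calH by exact: cvg_lim.
split; [| |by split; [exact: cvgP cvgH|]|rewrite HE; split].
- exact: hilbert_lower.
- exact: hilbert_upper.
- exact: long_path_meets_optimal.
- exact: hilbert_period_ge.
(* The range of [i] in (f) contains all [i <= V], because the factor [(1 - H) V + n + 1] is at least
   [1]. *)
move=> k k_large init; apply: hilbert_period_eq => // i iV; apply: init.
apply: (@le_trans _ _ V%:R); first by rewrite ler_nat.
rewrite ler_peMr// lerDr addr_ge0// mulr_ge0// subr_ge0.
exact: max_ratio_le1.
Qed.
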